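(* Let $\mathbf{S}$ be a finite skew lattice and $x\in S$. Then $x^{\downarrow^{*}}=\bigcup_{n\geq 0}x^{\downarrow^{*}}_{n}$, where the sets $x^{\downarrow^{*}}_{n}$ are defined recursively by $x^{\downarrow^{*}}_{0}=\{x\}$ and $$x^{\downarrow^{*}}_{n+1}=\bigcup\{\,z\wedge \mathcal D_{y}\wedge z : z\in x^{\downarrow^{*}}_{n},\ y\in S,\ y\lhd z\,\}.$$ Dually, $x^{\uparrow^{*}}=\bigcup_{n\geq 0}x^{\uparrow^{*}}_{n}$, where $x^{\uparrow^{*}}_{0}=\{x\}$ and $x^{\uparrow^{*}}_{n+1}=\bigcup\{\,z\vee \mathcal D_{y}\vee z : z\in x^{\uparrow^{*}}_{n},\ y\in S,\ z\lhd y\,\}$.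
   Context: A skew lattice $\mathbf S=(S;\wedge,\vee)$ is a nonempty set $S$ with two associative binary operations satisfying $x\wedge(x\vee y)=x=(y\vee x)\wedge x$ and $x\vee(x\wedge y)=x=(y\wedge x)\vee x$ for all $x,y\in S$. The natural partial order is: $y\leq x$ iff $x\wedge y=y=y\wedge x$ (equivalently $x\vee y=x=y\vee x$). Write $x\lhd y$ when $x<y$ and there is no $w\in S$ with $x<w<y$. The relation $\mathcal D$ is: $x\mathrel{\mathcal D}y$ iff $x\wedge y\wedge x=x$ and $y\wedge x\wedge y=y$; it is a congruence, and $\mathcal D_x$ denotes the $\mathcal D$-class of $x$. A nonempty $I\subseteq S$ closed under $\vee$ is a skew ideal if $u\in S$, $v\in I$, $u\leq v$ imply $u\in I$; a nonempty $F\subseteq S$ closed under $\wedge$ is a skew filter if $u\in S$, $v\in F$, $u\geq v$ imply $u\in F$. The principal skew ideal $x^{\downarrow^{*}}$ is the intersection of all skew ideals containing $x$; the principal skew filter $x^{\uparrow^{*}}$ is the intersection of all skew filters containing $x$. Notation: $z\wedge T\wedge z=\{z\wedge t\wedge z:t\in T\}$ and $z\vee T\vee z=\{z\vee t\vee z:t\in T\}$ for $T\subseteq S$. *)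

(* Defs.v *)
From HB Require Import structures.
From mathcomp Require Import all_boot all_classical.

Set Implicit Arguments.
Unset Strict Implicit.
Unset Printing Implicit Defensive.

Local Open Scope classical_set_scope.

Declare Scope skew_scope.
Delimit Scope skew_scope with skew.
Local Open Scope skew_scope.

Reserved Notation "x ⊓ y" (at level 48, left associativity).
Reserved Notation "x ⊔ y" (at level 52, left associativity).
Reserved Notation "x ⊑ y" (at level 70, no associativity).
Reserved Notation "x ⊏ y" (at level 70, no associativity).
Reserved Notation "x ⊲ y" (at level 70, no associativity).

(* The carrier is a bare Type, not an ordered type: neither operation is
   assumed commutative. *)
HB.mixin Record IsSkewLattice (S : Type) := {
  skew_meet : S -> S -> S;
  skew_join : S -> S -> S;
  skew_nonempty : inhabited S;
  skew_meetA : associative skew_meet;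
  skew_joinA : associative skew_join;
  skew_joinKl : forall x y : S, skew_meet x (skew_join x y) = x;
  skew_joinKr : forall x y : S, skew_meet (skew_join y x) x = x;
  skew_meetKl : forall x y : S, skew_join x (skew_meet x y) = x;
  skew_meetKr : forall x y : S, skew_join (skew_meet y x) x = x
}.

#[short(type="skewLatticeType")]
HB.structure Definition SkewLattice := { S of IsSkewLattice S }.

Notation "x ⊓ y" := (skew_meet x y) : skew_scope.
Notation "x ⊔ y" := (skew_join x y) : skew_scope.

Definition skew_le (S : skewLatticeType) (y x : S) : Prop :=
  x ⊓ y = y /\ y ⊓ x = y.
Notation "x ⊑ y" := (skew_le x y) : skew_scope.

Definition skew_lt (S : skewLatticeType) (y x : S) : Prop :=
  y ⊑ x /\ y <> x.
Notation "x ⊏ y" := (skew_lt x y) : skew_scope.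

Definition skew_covby (S : skewLatticeType) (x y : S) : Prop :=
  x ⊏ y /\ ~ (exists w : S, x ⊏ w /\ w ⊏ y).
Notation "x ⊲ y" := (skew_covby x y) : skew_scope.

Definition skew_D (S : skewLatticeType) (x y : S) : Prop :=
  x ⊓ y ⊓ x = x /\ y ⊓ x ⊓ y = y.

Definition Dclass (S : skewLatticeType) (x : S) : set S :=
  [set y | skew_D x y].

Definition skew_ideal (S : skewLatticeType) (I : set S) : Prop :=
  [/\ I !=set0,
      forall u v : S, I u -> I v -> I (u ⊔ v) &
      forall u v : S, I v -> u ⊑ v -> I u].

Definition skew_filter (S : skewLatticeType) (F : set S) : Prop :=
  [/\ F !=set0,
      forall u v : S, F u -> F v -> F (u ⊓ v) &
      forall u v : S, F v -> v ⊑ u -> F u].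

Definition principal_skew_ideal (S : skewLatticeType) (x : S) : set S :=
  \bigcap_(I in [set I : set S | skew_ideal I /\ I x]) I.

Definition principal_skew_filter (S : skewLatticeType) (x : S) : set S :=
  \bigcap_(F in [set F : set S | skew_filter F /\ F x]) F.

Definition meet_sandwich (S : skewLatticeType) (z : S) (T : set S) : set S :=
  [set z ⊓ t ⊓ z | t in T].

Definition join_sandwich (S : skewLatticeType) (z : S) (T : set S) : set S :=
  [set z ⊔ t ⊔ z | t in T].

Fixpoint down_layer (S : skewLatticeType) (x : S) (n : nat) : set S :=
  if n is m.+1 then
    \bigcup_(z in down_layer x m)
      \bigcup_(y in [set y : S | y ⊲ z]) meet_sandwich z (Dclass y)
  else [set x].

Fixpoint up_layer (S : skewLatticeType) (x : S) (n : nat) : set S :=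
  if n is m.+1 then
    \bigcup_(z in up_layer x m)
      \bigcup_(y in [set y : S | z ⊲ y]) join_sandwich z (Dclass y)
  else [set x].

(* Main.v *)
(* Both sides equal the order ideal {u | u ⊑ x}: the join of two elements below
   x is below x by associativity, so this set is already a skew ideal.  Every
   z ⊓ t ⊓ z lies below z, so the layers stay below x; conversely y ⊲ z gives
   y = z ⊓ y ⊓ z, so the union of the layers is closed under covers and hence,
   by finiteness, under ⊑.  The filter case is dual. *)
Require Import Defs.
From HB Require Import structures.
From mathcomp Require Import all_boot all_classical.

Local Open Scope classical_set_scope.
Local Open Scope skew_scope.

(** The rank of [b] is the number of elements strictly below it: transitivity makes these sets
    nested along [R], and irreflexivity makes the inclusion proper, with [a] itself as the new
    element. *)
Lemma finite_strict_order_rank (T : Type) (R : T -> T -> Prop) :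
  finite_set [set: T] ->
  (forall a b c, R a b -> R b c -> R a c) -> (forall a, ~ R a a) ->
  exists m : T -> nat, forall a b, R a b -> m a < m b.
Proof.
move=> [n /card_set_bijP[f [fS finj _]]] Rtrans Rirr.
(* [T] is a bare type, so elements are counted through their indices under [f]. *)
pose below b := [set i : 'I_n | `[< exists2 a, f a = i & R a b >]]%SET.
exists (fun b => #|below b|) => a b Rab.
have ltfa : f a < n by exact: fS.
apply/proper_card/properP; split.
  apply/fintype.subsetP => i; rewrite !finset.inE => /asboolP[c fc Rca].
  by apply/asboolP; exists c => //; exact: Rtrans Rca Rab.
exists (Ordinal ltfa); rewrite finset.inE; first by apply/asboolP; exists a.
by apply/asboolP => -[c /= fca]; rewrite (finj c a) ?inE//; exact: Rirr.
Qed.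

(** Induction on a bound for the rank gap [m b - m a]: either [b] covers [a], or an intermediate [w]
    splits the gap into two smaller ones, crossed from [b] to [w] and then from [w] to [a]. Keeping
    [R] abstract lets it be [⊏] or its converse. *)
Lemma finite_cover_closed (T : Type) (R : T -> T -> Prop) (U : set T) :
  finite_set [set: T] ->
  (forall a b c, R a b -> R b c -> R a c) -> (forall a, ~ R a a) ->
  (forall a b, U b -> R a b -> ~ (exists w, R a w /\ R w b) -> U a) ->
  forall a b, U b -> R a b -> U a.
Proof.
move=> finT Rtrans Rirr Ucov.
have [m mP] := finite_strict_order_rank _ R finT Rtrans Rirr.
suff closed k a b : m b - m a <= k -> U b -> R a b -> U a.
  by move=> a b; exact: closed (leqnn _).
elim: k a b => [|k IHk] a b lek Ub Rab.
  by move: lek; rewrite leqn0 subn_eq0 leqNgt (mP _ _ Rab).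
have [[w [Raw Rwb]]|nocov] := pselect (exists w, R a w /\ R w b); last first.
  exact: Ucov Ub Rab nocov.
have [ltaw ltwb] := (mP _ _ Raw, mP _ _ Rwb).
have ltab := ltn_trans ltaw ltwb.
apply: (IHk a w) => //.
  by rewrite -ltnS (leq_trans _ lek)// ltn_sub2r.
apply: (IHk w b) => //.
by rewrite -ltnS (leq_trans _ lek)// ltn_sub2l.
Qed.

Section SkewLatticeTheory.
Variable S : skewLatticeType.
Implicit Types x y z u v : S.

(** Absorption alone gives this: expand the second factor as [x ⊔ (x ⊓ x)]. *)
Lemma skew_meetxx x : x ⊓ x = x.
Proof. by rewrite -{2}(skew_meetKl x x) skew_joinKl. Qed.

Lemma skew_joinxx x : x ⊔ x = x.
Proof. by rewrite -{2}(skew_joinKl x x) skew_meetKl. Qed.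

(** Each equation follows from one absorption law; this form of the order serves every argument
    about joins. *)
Lemma skew_le_join y x : y ⊑ x <-> x ⊔ y = x /\ y ⊔ x = x.
Proof.
split=> [[xy yx]|[xy yx]]; split.
- by rewrite -xy skew_meetKl.
- by rewrite -yx skew_meetKr.
- by rewrite -xy skew_joinKr.
- by rewrite -yx skew_joinKl.
Qed.

Lemma skew_le_refl x : x ⊑ x.
Proof. by split; exact: skew_meetxx. Qed.

Lemma skew_le_anti x y : x ⊑ y -> y ⊑ x -> x = y.
Proof. by move=> [yx _] [_ <-]. Qed.

Lemma skew_le_trans y x z : x ⊑ y -> y ⊑ z -> x ⊑ z.
Proof.
move=> [yx xy] [zy yz]; split.
- by rewrite -yx skew_meetA zy.
- by rewrite -xy -skew_meetA yz.
Qed.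

Lemma skew_lt_trans x y z : x ⊏ y -> y ⊏ z -> x ⊏ z.
Proof.
move=> [lexy nexy] [leyz _]; split; first exact: skew_le_trans lexy leyz.
by move=> xz; apply: nexy; apply: skew_le_anti; rewrite // xz.
Qed.

Lemma skew_lt_irr x : ~ x ⊏ x.
Proof. by case. Qed.

Lemma Dclass_refl x : Dclass x x.
Proof. by split; rewrite !skew_meetxx. Qed.

Lemma skew_meet_sandwich_le z t : z ⊓ t ⊓ z ⊑ z.
Proof.
by split; [rewrite !skew_meetA skew_meetxx | rewrite -skew_meetA skew_meetxx].
Qed.

Lemma skew_join_sandwich_ge z t : z ⊑ z ⊔ t ⊔ z.
Proof. by split; [rewrite skew_joinKr | rewrite -skew_joinA skew_joinKl]. Qed.

Lemma principal_skew_idealE x : principal_skew_ideal x = [set u | u ⊑ x].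
Proof.
apply/seteqP; split=> [u|u ux I [[_ _ Idown] Ix]]; last exact: Idown Ix ux.
(* The intersection is instantiated at [[set u | u ⊑ x]] itself. *)
apply; split; last exact: skew_le_refl; split.
- by exists x; exact: skew_le_refl.
- move=> v w /skew_le_join[xv vx] /skew_le_join[xw wx].
  by apply/skew_le_join; rewrite skew_joinA xv xw -skew_joinA wx vx.
- by move=> v w wx vw; exact: skew_le_trans vw wx.
Qed.

Lemma principal_skew_filterE x : principal_skew_filter x = [set u | x ⊑ u].
Proof.
apply/seteqP; split=> [u|u xu F [[_ _ Fup] Fx]]; last exact: Fup Fx xu.
apply; split; last exact: skew_le_refl; split.
- by exists x; exact: skew_le_refl.
- move=> v w [vx xv] [wx xw].
  by split; [rewrite -skew_meetA wx vx | rewrite skew_meetA xv xw].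
- by move=> v w xw wv; exact: skew_le_trans xw wv.
Qed.

Lemma down_layer_le x n u : down_layer x n u -> u ⊑ x.
Proof.
elim: n u => [u ->|n IHn u [z /IHn zx [y _ [t _ <-]]]].
  exact: skew_le_refl.
exact: skew_le_trans (skew_meet_sandwich_le z t) zx.
Qed.

Lemma up_layer_ge x n u : up_layer x n u -> x ⊑ u.
Proof.
elim: n u => [u ->|n IHn u [z /IHn xz [y _ [t _ <-]]]].
  exact: skew_le_refl.
exact: skew_le_trans xz (skew_join_sandwich_ge z t).
Qed.

Lemma down_layer_covby x n y z :
  down_layer x n z -> y ⊲ z -> down_layer x n.+1 y.
Proof.
move=> xz yz; exists z => //; exists y => //; exists y; first exact: Dclass_refl.
by case: yz => -[[-> ->] _].
Qed.

Lemma up_layer_covby x n y z :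
  up_layer x n z -> z ⊲ y -> up_layer x n.+1 y.
Proof.
move=> xz zy; exists z => //; exists y => //; exists y; first exact: Dclass_refl.
by case: zy => -[/skew_le_join[yz zy] _] _; rewrite zy yz.
Qed.

Hypothesis finS : finite_set [set: S].

Lemma bigcup_down_layerE x : \bigcup_n down_layer x n = [set u | u ⊑ x].
Proof.
apply/seteqP; split=> [u [n _ /down_layer_le]//|u /= ux].
have x0 : (\bigcup_n down_layer x n) x by exists 0.
(* Closure is stated for a strict relation, so [x] is treated apart, by layer 0. *)
have [->//|neux] := pselect (u = x).
apply: (finite_cover_closed _ (@skew_lt S) _ finS skew_lt_trans skew_lt_irr _
  u x) => // a b [n _ xb] ab nocov.
by exists n.+1 => //; apply: down_layer_covby xb _.
Qed.

Lemma bigcup_up_layerE x : \bigcup_n up_layer x n = [set u | x ⊑ u].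
Proof.
apply/seteqP; split=> [u [n _ /up_layer_ge]//|u /= xu].
have x0 : (\bigcup_n up_layer x n) x by exists 0.
have [<-//|nexu] := pselect (x = u).
(* With the converse order, closure climbs from [x] up to [u]; the two conditions on an intermediate
   [w] get swapped. *)
apply: (finite_cover_closed _ (fun a b => b ⊏ a) _ finS _ skew_lt_irr _
  u x) => // [a b c ba cb|a b [n _ xb] ba nocov].
  exact: skew_lt_trans cb ba.
exists n.+1 => //; apply: up_layer_covby xb _.
by split=> // -[w [bw wa]]; apply: nocov; exists w.
Qed.

End SkewLatticeTheory.

Theorem proposition6p10 (S : skewLatticeType)
    (finS : finite_set [set: S]) (x : S) :
  principal_skew_ideal x = \bigcup_n down_layer x n /\
  principal_skew_filter x = \bigcup_n up_layer x n.
Proof.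
split.
- by rewrite principal_skew_idealE bigcup_down_layerE.
- by rewrite principal_skew_filterE bigcup_up_layerE.
Qed.
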